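(* Let $G$ and $H$ be groups with the same underlying set $X$ such that $\lambda_{(X,\mathcal{F}_G)}=\lambda_{(X,\mathcal{F}_H)}$. Then $\mathcal{F}_G=\mathcal{F}_H$.
   Context: A coarse structure on a set $X$ is a family $\mathcal{E}$ of subsets of $X\times X$ such that: each $E\in\mathcal{E}$ contains the diagonal $\triangle_X=\{(x,x):x\in X\}$; if $E,E'\in\mathcal{E}$ then $E\circ E'\in\mathcal{E}$ and $E^{-1}\in\mathcal{E}$, where $E\circ E'=\{(x,y):\exists z\,((x,z)\in E,\ (z,y)\in E')\}$ and $E^{-1}=\{(y,x):(x,y)\in E\}$; if $E\in\mathcal{E}$ and $\triangle_X\subseteq E'\subseteq E$ then $E'\in\mathcal{E}$; and $\bigcup\mathcal{E}=X\times X$. The pair $(X,\mathcal{E})$ is called a ballean (or coarse space). A subfamily $\mathcal{E}'\subseteq\mathcal{E}$ is a base for $\mathcal{E}$ if every $E\in\mathcal{E}$ is contained in some $E'\in\mathcal{E}'$. For $E\in\mathcal{E}$, $x\in X$, $A\subseteq X$: $E[x]=\{y\in X:(x,y)\in E\}$ and $E[A]=\bigcup_{a\in A}E[a]$. A subset $B\subseteq X$ is bounded if $B\subseteq E[x]$ for some $E\in\mathcal{E}$, $x\in X$; otherwise it is unbounded. Subsets $A,B$ of $X$ are close if there is $E\in\mathcal{E}$ with $A\subseteq E[B]$ and $B\subseteq E[A]$. They are linked, written $A\,\lambda_{(X,\mathcal{E})}\,B$, if either both $A,B$ are bounded or there exist unbounded subsets $A'\subseteq A$, $B'\subseteq B$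 that are close. For a group $G$, $\mathcal{F}_G$ denotes the coarse structure on $G$ with the base $\{\{(x,y)\in G\times G:y\in Fx\}\cup\triangle_G:F\in[G]^{<\omega}\}$, where $[G]^{<\omega}$ is the family of finite subsets of $G$ and $Fx=\{fx:f\in F\}$ is computed in $G$. *)

(* Defs.v *)
From mathcomp Require Import all_boot.
From mathcomp Require Import boolp classical_sets functions cardinality.

Set Implicit Arguments.
Unset Strict Implicit.
Unset Printing Implicit Defensive.

Local Open Scope classical_set_scope.
Local Open Scope relation_scope.

(* [E' \; E] is the set of (x, y) such that (x, z) \in E and (z, y) \in E' for
   some z, i.e., what is written E o E' for coarse structures. *)
Record coarse_structure (X : Type) (Es : set (set (X * X))) : Prop := {
  coarse_diagonal : forall E, Es E -> diagonal `<=` E;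
  coarse_compose : forall E E', Es E -> Es E' -> Es (E' \; E);
  coarse_inverse : forall E, Es E -> Es E^-1;
  coarse_subset : forall E E', Es E -> diagonal `<=` E' -> E' `<=` E -> Es E';
  coarse_cover : \bigcup_(E in Es) E = [set: X * X] }.

Definition coarse_base (X : Type) (Bs Es : set (set (X * X))) : Prop :=
  Bs `<=` Es /\ (forall E, Es E -> exists2 E', Bs E' & E `<=` E').

Definition coarse_generated (X : Type) (Bs : set (set (X * X))) :
    set (set (X * X)) :=
  [set E | diagonal `<=` E /\ exists2 E', Bs E' & E `<=` E'].

Lemma coarse_generated_unique (X : Type) (Bs Es : set (set (X * X))) :
  coarse_structure Es -> coarse_base Bs Es -> Es = coarse_generated Bs.
Proof.
move=> cE [BE EB]; apply/seteqP; split=> E.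
  by move=> EE; split; [exact: coarse_diagonal EE | exact: EB].
by move=> [dE [E' /BE EE' sE]]; exact: coarse_subset cE _ _ EE' dE sE.
Qed.

Definition bounded_subset (X : Type) (Es : set (set (X * X))) (B : set X) :
    Prop :=
  exists2 E, Es E & exists x, B `<=` xsection E x.

Definition close_subsets (X : Type) (Es : set (set (X * X))) (A B : set X) :
    Prop :=
  exists2 E, Es E &
    A `<=` \bigcup_(b in B) xsection E b /\
    B `<=` \bigcup_(a in A) xsection E a.

Definition linked (X : Type) (Es : set (set (X * X))) (A B : set X) : Prop :=
  (bounded_subset Es A /\ bounded_subset Es B) \/
  (exists A' B', [/\ A' `<=` A, B' `<=` B,
    ~ bounded_subset Es A', ~ bounded_subset Es B' & close_subsets Es A' B']).

Definition group_entourage (G : groupType) (F : set G) : set (G * G) :=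
  [set xy | [set (f * xy.1)%g | f in F] xy.2] `|` diagonal.

Definition group_coarse_base (G : groupType) : set (set (G * G)) :=
  [set group_entourage F | F in [set F : set G | finite_set F]].

Definition group_coarse (G : groupType) : set (set (G * G)) :=
  coarse_generated (@group_coarse_base G).

Arguments group_entourage : clear implicits.
Arguments group_coarse_base : clear implicits.
Arguments group_coarse : clear implicits.

Lemma group_coarse_structure (G : groupType) :
  coarse_structure (group_coarse G).
Proof.
split.
- by move=> E [].
- move=> E E' [dE [_ [F fF <-] sE]] [dE' [_ [F' fF' <-] sE']]; split.
    by move=> [x y] /= xy; exists x; [exact: dE | exact: dE'].
  pose K := [set (f' * f)%g | f' in F' & f in F] `|` (F `|` F').
  exists (group_entourage G K).
    exists K => //.
    by rewrite /K /= !finite_setU; split=> //; exact: finite_image2.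
  move=> [x y] [z /= /sE xz /sE' zy].
  case: xz => [[f Ff /= xz]|/diagonalP xz];
    case: zy => [[f' Ff' /= zy]|/diagonalP zy]; rewrite -zy -?xz.
  + left; exists (f' * f)%g; last by rewrite /= mulgA.
    by left; exists f' => //; exists f.
  + by left; exists f => //; right; left.
  + by left; exists f' => //; right; right.
  + by right.
- move=> E [dE [_ [F fF <-] sE]]; split.
    by move=> [x y] /diagonalP ->; exact: dE.
  exists (group_entourage G [set (f^-1)%g | f in F]).
    by exists [set (f^-1)%g | f in F] => //; exact: finite_image.
  move=> [x y] /= /sE [[f Ff /= <-]|/diagonalP ->]; last by right.
  by left; exists (f^-1)%g; [exists f | rewrite /= mulgA mulVg mul1g].
- move=> E E' [dE [B BB sE]] dE' sE'; split=> //.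
  by exists B => //; exact: subset_trans sE.
- apply/seteqP; split=> // -[x y] _.
  exists (group_entourage G [set (y * x^-1)%g]).
    split; first by move=> ?; right.
    exists (group_entourage G [set (y * x^-1)%g]) => //.
    by exists [set (y * x^-1)%g] => //; exact: finite_set1.
  by left; exists (y * x^-1)%g => //=; rewrite -mulgA mulVg mulg1.
Qed.

Lemma group_coarse_has_base (G : groupType) :
  coarse_base (group_coarse_base G) (group_coarse G).
Proof.
split=> [E BE|E [_]//]; split; last by exists E.
by case: BE => F _ <- x; right.
Qed.

(* Main.v *)
(* Boundedness in [group_coarse G] is finiteness, so two infinite sets A and B
   are linked iff g A meets B in an infinite set for some g in G.
   If the entourage of some g in G is not controlled in H, i.e., if
   (g x) x^-1 (the quotient being taken in H) takes infinitely many values,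
   one greedily extracts an infinite set A such that every h in H is of the
   form (g y) x^-1 for finitely many pairs (x, y) in A x A only; then A and g A
   are linked in G but not in H. *)

Require Import Defs.
From mathcomp Require Import all_boot.
From mathcomp Require Import boolp classical_sets functions cardinality.

Set Implicit Arguments.
Unset Strict Implicit.
Unset Printing Implicit Defensive.

Local Open Scope classical_set_scope.

(** The section at [x] of the entourage of a finite [F] is the finite set [F x] together with [x];
    conversely [B = B 1] lies in the section at [1] of its own entourage. *)
Lemma bounded_group_coarseP (G : groupType) (B : set G) :
  bounded_subset (group_coarse G) B <-> finite_set B.
Proof.
split=> [[E [_ [_ [F fF <-] sE]] [x BE]]|fB].
  apply: (@sub_finite_set _ _ ([set (f * x)%g | f in F] `|` [set x])).
    move=> y /BE; rewrite /xsection /= inE => /sE [[f Ff /= <-]|/diagonalP /= <-].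
      by left; exists f.
    by right.
  by rewrite finite_setU; split; [exact: finite_image|exact: finite_set1].
exists (group_entourage G B); last first.
  exists 1%g => y By; rewrite /xsection /= inE; left.
  by exists y; rewrite //= mulg1.
split; first by move=> ?; right.
by exists (group_entourage G B) => //; exists B.
Qed.

Lemma finite_preimage_translate (G : groupType) (B : set G) (g : G) :
  finite_set B -> finite_set [set x | B (g * x)%g].
Proof.
move=> fB; apply: (@sub_finite_set _ _ [set (g^-1 * y)%g | y in B]).
  by move=> x Bgx; exists (g * x)%g => //; rewrite mulgA mulVg mul1g.
exact: finite_image.
Qed.

Lemma linked_translate (G : groupType) (g : G) (A : set G) :
  infinite_set A -> linked (group_coarse G) A [set (g * x)%g | x in A].
Proof.
move=> iA; right; exists A, [set (g * x)%g | x in A].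
split=> //; first by move/bounded_group_coarseP.
  move/bounded_group_coarseP=> /(finite_preimage_translate g) fA; apply: iA.
  by apply: sub_finite_set fA => x Ax; exists x.
(* [g] carries [A] onto its translate and [g^-1] carries it back, which gives the two inclusions of
   closeness. *)
exists (group_entourage G [set g; g^-1%g]).
  split; first by move=> ?; right.
  exists (group_entourage G [set g; g^-1%g]) => //.
  by exists [set g; g^-1%g] => //; exact: finite_set2.
split=> [x Ax|_ [x Ax <-]].
  exists (g * x)%g; first by exists x.
  rewrite /xsection /= inE; left; exists g^-1%g; first by right.
  by rewrite /= mulgA mulVg mul1g.
exists x => //; rewrite /xsection /= inE; left.
by exists g => //; left.
Qed.

(** Pigeonhole: closeness covers the infinite [B'] by finitely many translates of parts of [A], with
    [1] standing for the diagonal, so one of these parts is infinite. *)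
Lemma linked_infinite_translate (H : groupType) (A B : set H) :
  infinite_set A -> linked (group_coarse H) A B ->
  exists h : H, infinite_set [set x | A x /\ B (h * x)%g].
Proof.
move=> iA [[/bounded_group_coarseP //]|[A' [B' [sA sB _ iB []]]]].
move=> E [_ [_ [F fF <-] sE]] [_ sBA].
apply: contrapT => /forallNP nh; apply: iB; apply/bounded_group_coarseP.
apply: (@sub_finite_set _ _ (\bigcup_(h in F `|` [set 1%g])
  [set (h * x)%g | x in [set x | A x /\ B (h * x)%g]])).
  move=> y B'y; have [a A'a] := sBA y B'y.
  rewrite /xsection /= inE => /sE [[f Ff /= fay]|/diagonalP /= ay].
    exists f; first by left.
    by exists a => //; split; [exact: sA|rewrite fay; exact: sB].
  exists 1%g; first by right.
  exists a; rewrite ?mul1g //; split; first exact: sA.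
  by rewrite mul1g ay; exact: sB.
apply: bigcup_finite => [|h _].
  by rewrite finite_setU; split=> //; exact: finite_set1.
by apply: finite_image; exact: contrapT (nh h).
Qed.

(* [g] is meant to be a left translation for another group law on [H], of which
   only injectivity matters. *)
Section GreedyExtraction.
Variables (H : groupType) (g : H -> H).
Hypothesis g_inj : injective g.

Let quotients (S : set H) : set H := [set (g y * x^-1)%g | y in S & x in S].

Lemma quotient_set_finite S : finite_set S -> finite_set (quotients S).
Proof. by move=> fS; exact: finite_image2. Qed.

Lemma fresh_extension (S : set H) :
  infinite_set (range (fun x => g x * x^-1)%g) -> finite_set S ->
  exists x, forall y, (x |` S) y ->
    ~ quotients S (g x * y^-1)%g /\ ~ quotients S (g y * x^-1)%g.
Proof.
move=> iD fS; have fK := quotient_set_finite fS.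
pose bad := [set x | exists2 y, S y &
  quotients S (g x * y^-1)%g \/ quotients S (g y * x^-1)%g].
have fbad : finite_set bad.
  (* For given [y] and quotient [k], [k = g x * y^-1] determines [g x], hence [x] by injectivity,
     and [k = g y * x^-1] determines [x] directly. *)
  apply: (@sub_finite_set _ _
    ((g @^-1` [set (k * y)%g | k in quotients S & y in S]) `|`
     [set (k^-1 * g y)%g | k in quotients S & y in S])).
    move=> x [y Sy [qxy|qyx]].
      left; exists (g x * y^-1)%g => //; exists y => //.
      by rewrite -mulgA mulVg mulg1.
    right; exists (g y * x^-1)%g => //; exists y => //.
    by rewrite invgM invgK mulgVK.
  rewrite finite_setU; split; last exact: finite_image2.
  apply: finite_preimage; last exact: finite_image2.
  by move=> ? ? _ _; exact: g_inj.
(* The infinite range is needed for the case [y = x]: a value outside [quotients S] and not attained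
   on [bad] comes from an [x] that settles all cases. *)
have : infinite_set (range (fun x => g x * x^-1)%g `\`
    (quotients S `|` [set (g x * x^-1)%g | x in bad])).
  apply: infinite_setD => //; rewrite finite_setU; split=> //.
  exact: finite_image.
move=> /infinite_setN0 [_ [[x _ <-] /not_orP [nK nbad]]].
exists x => y [->|Sy]; first by split.
by split=> q; apply: nbad; exists x => //; exists y => //; [left|right].
Qed.

Lemma sparse_quotients :
  infinite_set (range (fun x => g x * x^-1)%g) ->
  exists2 A : set H, infinite_set A &
    forall h, finite_set [set x | A x /\ [set g y | y in A] (h * x)%g].
Proof.
move=> iD.
(* Choice needs a total function; infinite [S] get the dummy value [1]. *)
have /choice [next nextP] : forall S : set H, exists x, finite_set S ->
    forall y, (x |` S) y ->
    ~ quotients S (g x * y^-1)%g /\ ~ quotients S (g y * x^-1)%g.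
  move=> S; have [fS|nfS] := pselect (finite_set S).
    by have [x xP] := fresh_extension iD fS; exists x.
  by exists 1%g.
(* [S n] consists of [a 0], ..., [a (n - 1)]. *)
pose S n := iter n (fun S => next S |` S) set0.
pose a n := next (S n).
have fS n : finite_set (S n).
  by elim: n => [|n IH] //=; rewrite finite_setU; split.
have Sa m n : m < n -> S n (a m).
  elim: n => // n IH; rewrite ltnS leq_eqVlt => /orP[/eqP ->|mn]; first by left.
  by right; exact: IH.
have fresh n m : m <= n ->
    ~ quotients (S n) (g (a n) * (a m)^-1)%g /\
    ~ quotients (S n) (g (a m) * (a n)^-1)%g.
  move=> mn; apply: nextP => //; move: mn.
  by rewrite leq_eqVlt => /orP[/eqP ->|/Sa]; [left|right].
have old n p q : p < n -> q < n -> quotients (S n) (g (a p) * (a q)^-1)%g.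
  by move=> pn qn; exists (a p); [exact: Sa|exists (a q) => //; exact: Sa].
(* A repetition would make [g (a n) * (a n)^-1] an old quotient. *)
have a_neq m n : m < n -> a m <> a n.
  move=> mn amn; have [+ _] := fresh n n (leqnn n).
  by rewrite -amn; apply; exact: old.
have a_inj : injective a.
  by move=> m n amn; case: (ltngtP m n) => // /a_neq; rewrite amn.
exists (range a) => [fa|h].
  apply: infinite_nat; rewrite -[setT](preimage_range a).
  by apply: finite_preimage fa => ? ? _ _; exact: a_inj.
(* [h] can only become a quotient at one stage of the construction. *)
have stage p q : h = (g (a q) * (a p)^-1)%g ->
    quotients (S (maxn p q).+1) h /\ ~ quotients (S (maxn p q)) h.
  move=> ->; split; first by apply: old; rewrite ltnS ?leq_maxl ?leq_maxr.
  by have [pq|/ltnW qp] := leqP p q; [have [] := fresh _ _ pq|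
    have [] := fresh _ _ qp].
have quotientsS m n : m <= n -> quotients (S m) `<=` quotients (S n).
  move=> mn k [y Sy [x Sx <-]].
  have SS z : S m z -> S n z.
    by elim: n mn => [|n IH]; rewrite leq_eqVlt => /orP[/eqP <- //|//];
      rewrite ltnS => /IH {}IH /IH; right.
  by exists y; [exact: SS|exists x => //; exact: SS].
have [[p0 [q0 h0]]|none] := pselect (exists p q, h = (g (a q) * (a p)^-1)%g);
    last first.
  apply: (@sub_finite_set _ _ set0) => // _ [[p _ <-] [_ [q _ <-] hE]].
  by apply: none; exists p, q; rewrite hE mulgK.
(* A pair [p], [q] giving [h] with a larger maximum than [p0], [q0] would not make [h] new, so [a p]
   is among finitely many terms. *)
apply: sub_finite_set (fS (maxn p0 q0).+1) => _ [[p _ <-] [_ [q _ <-] gE]].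
have hE : h = (g (a q) * (a p)^-1)%g by rewrite gE mulgK.
have [_ new] := stage _ _ hE; have [old0 _] := stage _ _ h0.
apply: Sa; rewrite ltnS; apply: leq_trans (leq_maxl p q) _.
by rewrite leqNgt; apply/negP => lt; apply: new; exact: quotientsS lt _ old0.
Qed.

End GreedyExtraction.

Lemma group_coarse_sub (X : Type) (cG cH : Group.axioms_ X) :
  linked (group_coarse (Group.Pack cG)) = linked (group_coarse (Group.Pack cH))
    :> (set X -> set X -> Prop) ->
  group_coarse (Group.Pack cG) `<=`
    (group_coarse (Group.Pack cH) : set (set (X * X))).
Proof.
set G := Group.Pack cG; set H := Group.Pack cH => lGH.
(* Inner product in [G], outer product and inverse in [H]: these are the elements of [H] needed to
   imitate left translation by [g]. *)
pose quo (g : G) : set H := range (fun x : H => ((g * (x : G))%g : H) * x^-1)%g.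
have fquo g : finite_set (quo g).
  apply: contrapT => iD.
  have [A iA fA] := @sparse_quotients H (fun x => (g * (x : G))%g) (mulgI g) iD.
  have := linked_translate g iA; rewrite lGH.
  by move=> /(@linked_infinite_translate H _ _ iA)[h]; apply; exact: fA.
move=> E [dE [_ [F fF <-] sE]]; split=> //.
exists (group_entourage H (\bigcup_(g in F) quo g)).
  by exists (\bigcup_(g in F) quo g) => //; exact: bigcup_finite.
move=> [x y] /sE [[g Fg /= <-]|/diagonalP ->]; last by right.
left; exists (((g * (x : G))%g : H) * (x : H)^-1)%g; last by rewrite /= mulgVK.
by exists g => //; exists x.
Qed.

Theorem theorem12 (X : Type) (cG cH : Group.axioms_ X) :
  linked (group_coarse (Group.Pack cG)) = linked (group_coarse (Group.Pack cH))
    :> (set X -> set X -> Prop) ->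
  group_coarse (Group.Pack cG) = group_coarse (Group.Pack cH)
    :> set (set (X * X)).
Proof.
by move=> lGH; apply/seteqP; split; apply: group_coarse_sub.
Qed.
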